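(* Let $\{x_i(t)\}$, $i\in V$, be generated by the distributed dual averaging updates (see context) with doubly stochastic matrix $P$. Let $x^*\in\mathcal{X}$ and suppose $\psi(x^* )\le R^2$. With the step size choice $\alpha(t)=\dfrac{R\sqrt{1-\sigma_2(P)}}{4L\sqrt{t}}$, we have $$f(\hat x_i(T))-f(x^* )\le 8\,\frac{RL}{\sqrt T}\,\frac{\log(T\sqrt n)}{\sqrt{1-\sigma_2(P)}}\qquad\text{for all } i\in V .$$
   Context: Problem: $G=(V,E)$ is an undirected graph with $V=\{1,\dots,n\}$, $n\ge2$; each $f_i:\mathbb{R}^d\to\mathbb{R}$ ($i\in V$) is convex; $\mathcal{X}\subseteq\mathbb{R}^d$ is closed and convex with $0\in\mathcal{X}$; $f(x)=\frac1n\sum_{i=1}^n f_i(x)$ is to be minimized over $\mathcal{X}$. Norms and Lipschitz assumption: $\|\cdot\|$ is a norm on $\mathbb{R}^d$ with dual norm $\|v\|_*=\sup_{\|u\|=1}\langle v,u\rangle$. Each $f_i$ is $L$-Lipschitz on $\mathcal{X}$: $|f_i(x)-f_i(y)|\le L\|x-y\|$ for $x,y\in\mathcal{X}$, and all subgradients $g\in\partial f_i(x)$, $x\in\mathcal{X}$, satisfy $\|g\|_*\le L$. Proximal function: $\psi:\mathbb{R}^d\to\mathbb{R}$ is differentiable and 1-strongly convex w.r.t. $\|\cdot\|$ on $\mathcal{X}$, i.e. $\psi(y)\ge\psi(x)+\langle\nabla\psi(x),y-x\rangle+\frac12\|x-y\|^2$ for all $x,y\in\mathcal{X}$; moreover $\psi\ge0$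 on $\mathcal{X}$ and $\psi(0)=0$. For $z\in\mathbb{R}^d$, $\alpha>0$ set $\Pi(z,\alpha)=\operatorname{argmin}_{x\in\mathcal{X}}\{\langle z,x\rangle+\frac1\alpha\psi(x)\}$. Communication matrix: $P\in\mathbb{R}^{n\times n}$ is a fixed doubly stochastic matrix (nonnegative entries, all row and column sums equal to 1), with $P_{ij}>0$ for $i\ne j$ only if $(i,j)\in E$ (diagonal entries may be positive). $\sigma_1(P)\ge\sigma_2(P)\ge\dots$ are its singular values; $\sigma_1(P)=1$ and it is understood that $\sigma_2(P)<1$, $R,L>0$. Distributed dual averaging: start with $z_i(1)=0$ and $x_i(1)=\Pi(0,\alpha(0))=0$ for all $i$ (the value $\alpha(0)>0$ is irrelevant). For $t\ge1$ each node $i$ picks $g_i(t)\in\partial f_i(x_i(t))$ and sets $z_i(t+1)=\sum_{j=1}^n P_{ij}z_j(t)+g_i(t)$ and $x_i(t+1)=\Pi(z_i(t+1),\alpha(t))$. The running local average is $\hat x_i(T)=\frac1T\sum_{t=1}^T x_i(t)$, $T\ge1$. *)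

(* Defs.v *)
(* MathComp-Analysis; [R^d] is ['rV[R]_d] over an arbitrary [R : realType]. *)
From HB Require Import structures.
From mathcomp Require Import all_boot all_order all_algebra.
From mathcomp Require Import polyrcf.
From mathcomp Require Import all_classical all_reals all_analysis.

Set Implicit Arguments.
Unset Strict Implicit.
Unset Printing Implicit Defensive.

Import Order.TTheory GRing.Theory Num.Theory.
Import numFieldNormedType.Exports.

Local Open Scope classical_set_scope.
Local Open Scope ring_scope.

Definition inner (R : realType) (d : nat) (u v : 'rV[R]_d) : R :=
  \sum_(k < d) u 0 k * v 0 k.

(* Nonnegativity follows from the triangle inequality and homogeneity. *)
Record is_norm (R : realType) (d : nat) (N : 'rV[R]_d -> R) : Prop := {
  norm_triangle : forall u v, N (u + v) <= N u + N v;
  norm_homogeneous : forall (a : R) u, N (a *: u) = `|a| * N u;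
  norm_definite : forall u, N u = 0 -> u = 0
}.

Definition dual_norm (R : realType) (d : nat) (N : 'rV[R]_d -> R)
    (v : 'rV[R]_d) : R :=
  sup [set inner v u | u in [set u | N u = 1]].

(* The subgradient inequality is required on all of R^d, not only on the
   constraint set. *)
Definition subdifferential (R : realType) (d : nat) (f : 'rV[R]_d -> R)
    (x : 'rV[R]_d) : set 'rV[R]_d :=
  [set g | forall y, f x + inner g (y - x) <= f y].

Definition lipschitz_wrt (R : realType) (d : nat) (N : 'rV[R]_d -> R)
    (X : set 'rV[R]_d) (L : R) (f : 'rV[R]_d -> R) : Prop :=
  forall x y, X x -> X y -> `|f x - f y| <= L * N (x - y).

Definition gradient (R : realType) (d : nat) (psi : 'rV[R]_d -> R)
    (x : 'rV[R]_d) : 'rV[R]_d :=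
  \row_(k < d) 'D_('e_k) psi x.

Definition strongly_convex1 (R : realType) (d : nat) (N : 'rV[R]_d -> R)
    (X : set 'rV[R]_d) (psi : 'rV[R]_d -> R) : Prop :=
  forall x y, X x -> X y ->
    psi x + inner (gradient psi x) (y - x) + 2^-1 * N (x - y) ^+ 2 <= psi y.

Record proximal_function (R : realType) (d : nat) (N : 'rV[R]_d -> R)
    (X : set 'rV[R]_d) (psi : 'rV[R]_d -> R) : Prop := {
  prox_differentiable : forall x, differentiable psi x;
  prox_strongly_convex : strongly_convex1 N X psi;
  prox_ge0 : forall x, X x -> 0 <= psi x;
  prox_at0 : psi 0 = 0
}.

Definition argmin (T : Type) (R : realType) (X : set T) (F : T -> R) : set T :=
  [set x | X x /\ forall y, X y -> F x <= F y].

(* The set of minimizers; for X closed convex nonempty, psi a proximal function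
   and a > 0, it is a singleton. *)
Definition projection (R : realType) (d : nat) (X : set 'rV[R]_d)
    (psi : 'rV[R]_d -> R) (z : 'rV[R]_d) (a : R) : set 'rV[R]_d :=
  argmin X (fun x => inner z x + a^-1 * psi x).

Record doubly_stochastic (R : realType) (n : nat) (P : 'M[R]_n) : Prop := {
  ds_ge0 : forall i j, 0 <= P i j;
  ds_row : forall i, \sum_j P i j = 1;
  ds_col : forall j, \sum_i P i j = 1
}.

Definition respects_graph (R : realType) (n : nat) (E : rel 'I_n)
    (P : 'M[R]_n) : Prop :=
  forall i j, i != j -> 0 < P i j -> E i j.

(* Square roots of the eigenvalues of A^T A, repeated according to algebraic
   multiplicity, in nonincreasing order ([rootsR] is increasing and without
   repetition). *)
Definition singular_values (R : realType) (n : nat) (A : 'M[R]_n) : seq R :=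
  let p := char_poly (A^T *m A) in
  rev [seq Num.sqrt x | x <- flatten [seq nseq (mup x p) x | x <- rootsR p]].

(* Singular values are numbered from 1. *)
Definition singular_value (R : realType) (n : nat) (A : 'M[R]_n) (k : nat) : R :=
  nth 0 (singular_values A) k.-1.

(* Time starts at 1; the values of x, z and g at time 0 are unconstrained. *)
Record dual_averaging (R : realType) (n d : nat) (P : 'M[R]_n)
    (X : set 'rV[R]_d) (psi : 'rV[R]_d -> R) (f : 'I_n -> 'rV[R]_d -> R)
    (alpha : nat -> R) (x z g : 'I_n -> nat -> 'rV[R]_d) : Prop := {
  da_z1 : forall i, z i 1%N = 0;
  da_x1 : forall i, x i 1%N = 0;
  da_subgradient : forall i t, (0 < t)%N -> subdifferential (f i) (x i t) (g i t);
  da_z : forall i t, (0 < t)%N ->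
    z i t.+1 = \sum_(j < n) P i j *: z j t + g i t;
  da_x : forall i t, (0 < t)%N -> projection X psi (z i t.+1) (alpha t) (x i t.+1)
}.

Definition running_average (R : realType) (d : nat) (x : nat -> 'rV[R]_d)
    (T : nat) : 'rV[R]_d :=
  T%:R^-1 *: \sum_(1 <= t < T.+1) x t.

Definition network_objective (R : realType) (n d : nat)
    (f : 'I_n -> 'rV[R]_d -> R) (x : 'rV[R]_d) : R :=
  n%:R^-1 * \sum_(i < n) f i x.

(* Main.v *)
(* The iterates are compared with the centralized dual averaging sequence [y],
   where [y t] minimizes [<zbar t, u> + psi u / alpha (t - 1)] for the network
   average [zbar] of the dual variables.  Strong convexity of [psi] makes the
   minimizer [alpha]-Lipschitz in [z], so [y] obeys the usual regret bound and
   [x i t] differs from it by at most [alpha (t - 1) * |z i t - zbar t|_*].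
   Unrolling the recursion, [z i - zbar] is a sum of terms of dual norm at most
   [L] times the l1 norm of the row [(e_i - 1/n) P^k], which is at most [2] and
   at most [sqrt n * sigma_2^k]; splitting the sum at
   [k = ln (T sqrt n) / (1 - sigma_2)] bounds it by
   [2 ln (T sqrt n) / (1 - sigma_2) + 3].
   The constants add up to the factor 8 only when [ln (T sqrt n) >= 7/4]; for
   [T < 16] the iterates are still so close to [0] that the Lipschitz property
   of the objective suffices. *)
Require Import Defs.
From mathcomp Require Import all_boot all_order all_algebra.
From mathcomp Require Import polyrcf.
From mathcomp Require Import all_classical all_reals all_analysis.
From mathcomp Require Import lra ring.
Import Order.TTheory GRing.Theory Num.Theory.
Import numFieldNormedType.Exports.
Local Open Scope classical_set_scope.
Local Open Scope ring_scope.

Set Implicit Arguments.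
Unset Strict Implicit.
Unset Printing Implicit Defensive.

(** * The standard inner product on row vectors *)

Lemma innerE (R : realType) d (u v : 'rV[R]_d) : inner u v = (u *m v^T) 0 0.
Proof. by rewrite mxE; apply: eq_bigr => k _; rewrite mxE. Qed.

Lemma innerC (R : realType) d (u v : 'rV[R]_d) : inner u v = inner v u.
Proof. by apply: eq_bigr => k _; rewrite mulrC. Qed.

Lemma innerDl (R : realType) d (u v w : 'rV[R]_d) :
  inner (u + v) w = inner u w + inner v w.
Proof. by rewrite !innerE mulmxDl mxE. Qed.

Lemma innerZl (R : realType) d a (u w : 'rV[R]_d) :
  inner (a *: u) w = a * inner u w.
Proof. by rewrite !innerE -scalemxAl mxE. Qed.

Lemma innerNl (R : realType) d (u w : 'rV[R]_d) : inner (- u) w = - inner u w.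
Proof. by rewrite -scaleN1r innerZl mulN1r. Qed.

Lemma innerBl (R : realType) d (u v w : 'rV[R]_d) :
  inner (u - v) w = inner u w - inner v w.
Proof. by rewrite innerDl innerNl. Qed.

Lemma innerDr (R : realType) d (u v w : 'rV[R]_d) :
  inner w (u + v) = inner w u + inner w v.
Proof. by rewrite !(innerC w) innerDl. Qed.

Lemma innerZr (R : realType) d a (u w : 'rV[R]_d) :
  inner w (a *: u) = a * inner w u.
Proof. by rewrite !(innerC w) innerZl. Qed.

Lemma innerNr (R : realType) d (u w : 'rV[R]_d) : inner w (- u) = - inner w u.
Proof. by rewrite !(innerC w) innerNl. Qed.

Lemma innerBr (R : realType) d (u v w : 'rV[R]_d) :
  inner w (u - v) = inner w u - inner w v.
Proof. by rewrite innerDr innerNr. Qed.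

Lemma inner0l (R : realType) d (u : 'rV[R]_d) : inner 0 u = 0.
Proof. by rewrite innerE mul0mx mxE. Qed.

Lemma inner_suml (R : realType) d (I : Type) (r : seq I) (p : pred I)
    (F : I -> 'rV[R]_d) w :
  inner (\sum_(i <- r | p i) F i) w = \sum_(i <- r | p i) inner (F i) w.
Proof.
apply: (big_morph (fun u => inner u w)); last exact: inner0l.
by move=> u v; exact: innerDl.
Qed.

Lemma inner_mulmx (R : realType) n (u v : 'rV[R]_n) (A : 'M[R]_n) :
  inner (u *m A) v = inner u (v *m A^T).
Proof. by rewrite !innerE trmx_mul trmxK mulmxA. Qed.

Lemma inner_ge0 (R : realType) d (u : 'rV[R]_d) : 0 <= inner u u.
Proof. by apply: sumr_ge0 => k _; rewrite -expr2 sqr_ge0. Qed.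

Lemma inner_eq0 (R : realType) d (u : 'rV[R]_d) : inner u u = 0 -> u = 0.
Proof.
move=> /eqP; rewrite psumr_eq0 => [/allP u0|k _]; last by rewrite -expr2 sqr_ge0.
apply/rowP => k; have := u0 k (mem_index_enum _).
by rewrite -expr2 sqrf_eq0 mxE => /eqP.
Qed.

Lemma inner_gt0 (R : realType) d (u : 'rV[R]_d) : u != 0 -> 0 < inner u u.
Proof.
move=> u0; rewrite lt_neqAle inner_ge0 andbT eq_sym.
by apply: contraNneq u0 => /inner_eq0 ->.
Qed.

Lemma cauchy_schwarz (R : realType) d (u v : 'rV[R]_d) :
  inner u v ^+ 2 <= inner u u * inner v v.
Proof.
have [->|u0] := eqVneq u 0; first by rewrite !inner0l mul0r expr0n.
have a0 := inner_gt0 u0.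
have := inner_ge0 (inner u u *: v - inner u v *: u).
rewrite !(innerBl, innerBr, innerZl, innerZr) (innerC v u) => H.
rewrite -subr_ge0 -(pmulr_rge0 _ a0); apply: le_trans H _.
by apply/eqP/eqP; lra.
Qed.

Lemma continuous_inner (R : realType) d (T : topologicalType)
    (F G : T -> 'rV[R]_d) :
  continuous F -> continuous G -> continuous (fun x => inner (F x) (G x)).
Proof.
move=> cF cG; apply: continuous_big; first exact: add_continuous.
move=> k _ x; apply: cvgM.
- apply: (@continuous_comp _ _ _ F (fun M : 'rV[R]_d => M 0 k)); first exact: cF.
  exact: coord_continuous.
- apply: (@continuous_comp _ _ _ G (fun M : 'rV[R]_d => M 0 k)); first exact: cG.
  exact: coord_continuous.
Qed.

(** * Multiplicity of eigenvalues and the second singular value *)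

(** Geometric multiplicity is at most algebraic multiplicity. Complete the row space of [B] to a
    basis [Q]: the first [r] rows of [Q ('X - A)] are multiples of ['X - a], so that many factors
    come out of the determinant. *)
Lemma char_poly_dvd_eigenspace (F : fieldType) n r (A : 'M[F]_n)
    (B : 'M[F]_(r, n)) a :
  row_free B -> B *m A = a *: B -> ('X - a%:P) ^+ r %| char_poly A.
Proof.
move=> Bfree BA.
have rE : \rank B = r by apply/eqP.
have rn : (r <= n)%N by rewrite -rE rank_leq_col.
pose Q := row_ebase B.
have Qu : Q \in unitmx by exact: row_ebase_unit.
have QA : pid_mx r *m Q *m A = a *: (pid_mx r *m Q) :> 'M[F]_(r, n).
  (* The first [r] rows of [Q] are combinations of rows of [B], hence eigenvectors. *)
  have -> : pid_mx r *m Q = invmx (col_ebase B) *m B :> 'M[F]_(r, n).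
    by rewrite -{2}(mulmx_ebase B) rE -!mulmxA mulKmx // col_ebase_unit.
  by rewrite -mulmxA BA scalemxAr.
pose QA' := map_mx polyC Q *m char_poly_mx A.
pose D : 'rV[{poly F}]_n :=
  \row_(i < n) (if (i < r)%N then 'X - a%:P else 1).
pose M : 'M[{poly F}]_n :=
  \matrix_(i < n) (if (i < r)%N then row i (map_mx polyC Q) else row i QA').
have E : QA' = diag_mx D *m M.
  apply/row_matrixP => i.
  have -> : row i (diag_mx D *m M) = D 0 i *: row i M.
    by apply/rowP => j; rewrite mul_diag_mx !mxE.
  rewrite mxE rowK.
  case: ifP => ir; last by rewrite scale1r.
  have Qi : row i Q *m A = a *: row i Q.
    have := congr1 (row (Ordinal ir)) QA.
    rewrite -!mulmxA linearZ /= !row_mul.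
    have -> : row (Ordinal ir) (pid_mx r) = delta_mx 0 i :> 'rV[F]_n.
      apply/rowP => j; rewrite !mxE eqxx /= ir andbT.
      by rewrite [j == i]eq_sym.
    by rewrite mulmxA -rowE.
  rewrite row_mul /char_poly_mx mulmxBr mul_mx_scalar -map_row -map_mxM Qi.
  by rewrite map_mxZ scalerBl.
have detD : \det (diag_mx D) = ('X - a%:P) ^+ r.
  rewrite det_diag
    (eq_bigr (fun i : 'I_n => if (i < r)%N then 'X - a%:P else 1)); last first.
    by move=> i _; rewrite mxE.
  rewrite -big_mkcond /= (big_ord_narrow rn).
  by rewrite prodr_const card_ord.
have := congr1 determinant E; rewrite !det_mulmx detD det_map_mx => detE.
have Q0 : \det Q != 0 by rewrite -unitfE -unitmxE.
rewrite -(@dvdpZr _ (\det Q)) // -mul_polyC /char_poly detE.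
by rewrite dvdp_mulr.
Qed.

Lemma sorted_flatten_nseq (R : realType) (m : R -> nat) (s : seq R) :
  sorted <%R s -> sorted <=%R (flatten [seq nseq (m x) x | x <- s]).
Proof.
rewrite (sorted_pairwise lt_trans) (sorted_pairwise le_trans).
elim: s => //= x s IH /andP[xs /IH ss].
rewrite pairwise_cat ss andbT; apply/andP; split.
  apply/allrelP => y w /nseqP[-> _] /flatten_mapP[v vs /nseqP[-> _]].
  exact/ltW/(allP xs).
by elim: (m x) => //= k ->; rewrite andbT all_nseq lexx orbT.
Qed.

Lemma second_largest_ge (R : realType) (s : seq R) (c : R) :
  sorted <=%R s -> (2 <= count (fun x => (c <= x)%R) s)%N ->
  (1 < size s)%N /\ c <= nth 0 (rev s) 1.
Proof.
case/lastP: s => // s y; case/lastP: s => [|s x].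
  by move=> _ /=; case: (c <= y).
rewrite !size_rcons !rev_rcons /= => ss cs; split => //.
rewrite leNgt; apply/negP => xc; move: cs; rewrite -!cats1 !count_cat /=.
rewrite (leNgt c x) xc /= addn0.
move: ss; rewrite (sorted_pairwise le_trans) -!cats1 !pairwise_cat.
move=> /and3P[_ /and3P[/allrelP sx _ _] _].
have -> : count [eta <=%R c] s = 0%N.
  apply/eqP; rewrite -leqn0 leqNgt -has_count; apply/hasPn => w ws.
  by rewrite -ltNge (le_lt_trans _ xc) // sx // mem_head.
by case: (c <= y).
Qed.

(** When the two values agree a double root is required, so in either case they fill two places in
    the list of eigenvalues with multiplicity; two entries are then at least [min a b], and so is
    the second largest. *)
Lemma singular_value2_ge (R : realType) n (A : 'M[R]_n) (a b : R) :
  0 <= a -> 0 <= b ->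
  (if a == b then ('X - a%:P) ^+ 2 %| char_poly (A^T *m A)
   else root (char_poly (A^T *m A)) a && root (char_poly (A^T *m A)) b) ->
  Num.sqrt (Num.min a b) <= singular_value A 2.
Proof.
move=> a0 b0; rewrite /singular_value /singular_values.
set p := char_poly _ => H.
have p0 : p != 0 by rewrite monic_neq0 ?char_poly_monic.
set s := flatten _.
have ss : sorted <=%R s by apply: sorted_flatten_nseq; exact: sorted_roots.
have mups x : root p x -> (0 < mup x p)%N.
  by rewrite -XsubC_dvd // -root_factor_theorem.
have rootsE x : root p x -> x \in rootsR p.
  by rewrite -roots_on_rootsR // inE.
have cnt : (2 <= count (fun x => (Num.min a b <= x)%R) s)%N.
  rewrite /s count_flatten -map_comp sumnE big_map.
  under eq_bigr => x _ do rewrite /= count_nseq.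
  have [eab|nab] := eqVneq a b.
    move: H; rewrite eab eqxx -mup_geq // => m2.
    have rb : b \in rootsR p.
      by apply: rootsE; rewrite root_factor_theorem XsubC_dvd // (leq_trans _ m2).
    rewrite (bigD1_seq b) ?uniq_roots //=.
    by rewrite minxx lexx mul1n (leq_trans m2) // leq_addr.
  move: H; rewrite (negPf nab) => /andP[ra rb].
  rewrite (bigD1_seq a) ?uniq_roots ?rootsE //=.
  rewrite big_mkcond (bigD1_seq b) ?uniq_roots ?rootsE //=.
  rewrite eq_sym nab.
  rewrite !ge_min !lexx orbT !mul1n.
  by rewrite addnA (leq_trans _ (leq_addr _ _)) // (leq_add (mups _ ra) (mups _ rb)).
have [s2 le2] := second_largest_ge ss cnt.
rewrite -map_rev (nth_map 0) ?size_rev //.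
by rewrite ler_sqrt // (le_trans _ le2) // le_min a0.
Qed.

(** * Contraction on the orthogonal complement of the constants *)

Lemma mx_norm_leP (R : realType) d (u : 'rV[R]_d) (r : R) :
  0 <= r -> (forall k, `|u 0 k| <= r) -> `|u| <= r.
Proof.
move=> r0 ur; rewrite [leLHS]/Num.norm /= mx_normrE.
by apply/bigmax_leP; split => // -[i k] _ /=; rewrite ord1.
Qed.

(* At a maximizer [v] of the Rayleigh quotient on the invariant subspace, the
   residual [v A - lam v] lies in the subspace and is orthogonal to it. *)
Lemma rayleigh_eigenvector (R : realType) n (A : 'M[R]_n) (e : 'rV[R]_n) c :
  A^T = A -> e *m A = c *: e ->
  (exists2 w : 'rV[R]_n, inner w e = 0 & w != 0) ->
  exists (lam : R) (v : 'rV[R]_n),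
    [/\ v != 0, inner v e = 0, v *m A = lam *: v &
        forall w, inner w e = 0 -> inner (w *m A) w <= lam * inner w w].
Proof.
move=> Asym eA [w0 w0e w0N].
pose K := [set w : 'rV[R]_n | inner w e = 0 /\ inner w w = 1].
have normalize w : inner w e = 0 -> w != 0 ->
    K ((Num.sqrt (inner w w))^-1 *: w).
  move=> we w0'; have w2 := inner_gt0 w0'; split; rewrite !(innerZl, innerZr).
    by rewrite we mulr0.
  by rewrite mulrA -invfM -expr2 sqr_sqrtr ?mulVf ?lt0r_neq0 // ltW.
have cI : continuous (fun w : 'rV[R]_n => w) by move=> x; exact: cvg_id.
have cC (B : 'rV[R]_n) : continuous (fun _ : 'rV[R]_n => B).
  exact: cst_continuous.
have cA : continuous (fun w : 'rV[R]_n => inner (w *m A) w).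
  have -> : (fun w : 'rV[R]_n => inner (w *m A) w) =
      (fun w => \sum_(k < n) inner w (row k A^T) * w 0 k).
    apply/funext => w; apply: eq_bigr => k _; congr (_ * _).
    by rewrite mxE; apply: eq_bigr => i _; rewrite !mxE.
  apply: continuous_big; first exact: add_continuous.
  move=> k _ x; apply: cvgM; first exact: (nbhs_filter x).
    exact: (continuous_inner cI (cC (row k A^T)) (x := x)).
  exact: coord_continuous.
have cK : compact K.
  apply: bounded_closed_compact.
    exists 1; split; first exact: real1.
    move=> M M1 w [_ w1]; apply: mx_norm_leP => [|k].
      by rewrite ltW // (lt_trans _ M1).
    apply: le_trans (ltW M1).
    rewrite -(@ler_pXn2r _ 2) ?nnegrE // expr1n real_normK ?num_real // -w1.
    rewrite /inner (bigD1 k) //= -expr2 lerDl.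
    by apply: sumr_ge0 => i _; rewrite -expr2 sqr_ge0.
  have -> : K = (fun w => inner w e) @^-1` [set 0] `&`
      (fun w => inner w w) @^-1` [set 1].
    by [].
  apply: closedI; apply: closed_comp; try exact: closed_eq.
  - by move=> x _; exact: (continuous_inner cI (cC e) (x := x)).
  - by move=> x _; exact: (continuous_inner cI cI (x := x)).
have K0 : K !=set0 by exists ((Num.sqrt (inner w0 w0))^-1 *: w0); exact: normalize.
have [|v /set_mem[ve v1] vmax] :=
  @EVT_max_rV R n (fun w => inner (w *m A) w) K K0 cK.
  by apply: continuous_subspaceT.
pose lam := inner (v *m A) v.
have bnd w : inner w e = 0 -> inner (w *m A) w <= lam * inner w w.
  move=> we; have [->|w1] := eqVneq w 0; first by rewrite mul0mx !inner0l mulr0.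
  have := vmax _ (mem_set (normalize _ we w1)).
  have w2 := inner_gt0 w1.
  rewrite -scalemxAl innerZl innerZr mulrA -invfM -expr2 sqr_sqrtr ?(ltW w2) //.
  by rewrite ler_pdivrMl // [leRHS]mulrC.
exists lam, v; split => //.
  by apply: contra_eq_neq v1 => ->; rewrite inner0l eq_sym oner_neq0.
apply/eqP; rewrite -subr_eq0; apply/eqP/inner_eq0.
set u := _ - _.
have ue : inner u e = 0.
  rewrite /u innerBl innerZl ve mulr0 subr0 inner_mulmx Asym eA innerZr ve.
  by rewrite mulr0.
have uv : inner (u *m A) v = inner (v *m A) u.
  by rewrite inner_mulmx Asym innerC.
have uu : inner u u = inner (v *m A) u - lam * inner v u.
  by rewrite {1}/u innerBl innerZl.
move: u ue uv uu => u ue uv uu.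
set q := inner u u in uu *; set m := lam * q - inner (u *m A) u.
have m0 : 0 <= m by rewrite subr_ge0 bnd.
(* Optimality of [v] tested at the competitor [v + t u]: the left side is the first-order term, [m]
   collects the second-order ones. *)
have opt t : 2 * t * q <= t ^+ 2 * m.
  have := bnd (v + t *: u); rewrite innerDl innerZl ve ue mulr0 addr0.
  move=> /(_ erefl); rewrite mulmxDl -scalemxAl.
  rewrite !(innerDl, innerZl, innerDr, innerZr) uv v1.
  by rewrite (innerC u v) -/lam -/q /m uu; lra.
(* The optimal [t] would be [q / m], but [m] may vanish. With [m + 1] the inequality reads
   [2 (m + 1) t^2 <= m t^2], which forces [t = 0] and so [q = 0]. *)
have := opt (q / (m + 1)).
have m1 : 0 < m + 1 by lra.
have -> : 2 * (q / (m + 1)) * q = 2 * (m + 1) * (q / (m + 1)) ^+ 2.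
  by field; rewrite gt_eqF.
rewrite mulrC -subr_ge0 -mulrBr => H.
have : (q / (m + 1)) ^+ 2 <= 0.
  rewrite leNgt; apply/negP => h; move: H; rewrite pmulr_rge0 //; lra.
rewrite le_eqVlt ltNge sqr_ge0 orbF sqrf_eq0 mulf_eq0 invr_eq0 (gt_eqF m1) orbF.
by move/eqP.
Qed.

Lemma singular_value_ge0 (R : realType) n (A : 'M[R]_n) k :
  0 <= singular_value A k.
Proof.
rewrite /singular_value /singular_values -map_rev; set s := rev _.
have [ks|ks] := ltnP k.-1 (size s); last by rewrite nth_default ?size_map.
by rewrite (nth_map 0) ?sqrtr_ge0.
Qed.

Lemma trmx_doubly_stochastic (R : realType) n (P : 'M[R]_n) :
  doubly_stochastic P -> doubly_stochastic P^T.
Proof.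
case=> p0 pr pc; split => [i j|i|i]; first by rewrite mxE.
  by rewrite -[RHS](pc i); apply: eq_bigr => j _; rewrite mxE.
by rewrite -[RHS](pr i); apply: eq_bigr => j _; rewrite mxE.
Qed.

Lemma const_mx_doubly_stochastic (R : realType) n (P : 'M[R]_n) (a : R) :
  doubly_stochastic P -> const_mx a *m P = const_mx a :> 'rV[R]_n.
Proof.
move=> Pds; apply/rowP => j; rewrite !mxE -[RHS]mulr1 -(ds_col Pds j) mulr_sumr.
by apply: eq_bigr => i _; rewrite mxE.
Qed.

(** [P^T P] has the eigenvector [e] for 1 and, on the complement of [e], an eigenvector for the
    maximal Rayleigh quotient [lam]. These two eigenvalues force [min 1 lam <= sigma_2^2], and
    [sigma_2 < 1] leaves only [lam <= sigma_2^2]. *)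
Lemma inner_mulmx_trmx_le (R : realType) n (P : 'M[R]_n) (w : 'rV[R]_n) :
  doubly_stochastic P -> singular_value P 2 < 1 -> inner w (const_mx 1) = 0 ->
  inner (w *m P^T) (w *m P^T) <= singular_value P 2 ^+ 2 * inner w w.
Proof.
move=> Pds s1 we; have [->|w0] := eqVneq w 0.
  by rewrite mul0mx !inner0l mulr0.
set e : 'rV[R]_n := const_mx 1; pose A := P^T *m P.
have Asym : A^T = A by rewrite trmx_mul trmxK.
have eA : e *m A = 1 *: e.
  rewrite mulmxA (const_mx_doubly_stochastic _ (trmx_doubly_stochastic Pds)).
  by rewrite (const_mx_doubly_stochastic _ Pds) scale1r.
have [lam [v [v0 ve vA lammax]]] :=
  rayleigh_eigenvector Asym eA (ex_intro2 _ _ w we w0).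
have quad u : inner (u *m A) u = inner (u *m P^T) (u *m P^T).
  by rewrite mulmxA [LHS]inner_mulmx.
rewrite -quad; apply: le_trans (lammax w we) _.
apply: ler_wpM2r; first exact: inner_ge0.
have lam0 : 0 <= lam.
  rewrite -(pmulr_lge0 _ (inner_gt0 v0)) -innerZl -vA quad; exact: inner_ge0.
have e0 : e != 0.
  apply: contra_neq w0 => e0; apply/rowP => k.
  have := congr1 (fun v : 'rV[R]_n => v 0 k) e0; rewrite !mxE => /eqP.
  by rewrite oner_eq0.
have := @singular_value2_ge R n P 1 lam ler01 lam0.
case: ifPn => [/eqP elam|nlam].
  (* If [lam = 1], the orthogonal vectors [e] and [v] make 1 a double eigenvalue, so [sigma_2 >= 1],
     a contradiction. *)
  have Bfree : row_free (col_mx e v).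
    apply: inj_row_free => x; rewrite -[x]hsubmxK mul_row_col.
    rewrite [lsubmx x]mx11_scalar [rsubmx x]mx11_scalar !mul_scalar_mx.
    set a := lsubmx x 0 0; set b := rsubmx x 0 0 => H.
    have a0 : a = 0.
      have := congr1 (fun u => inner u e) H.
      rewrite innerDl !innerZl ve mulr0 addr0 inner0l => /eqP.
      by rewrite mulf_eq0 (gt_eqF (inner_gt0 e0)) orbF => /eqP.
    have b0 : b = 0.
      have := congr1 (fun u => inner u v) H.
      rewrite innerDl !innerZl a0 mul0r add0r inner0l => /eqP.
      by rewrite mulf_eq0 (gt_eqF (inner_gt0 v0)) orbF => /eqP.
    by rewrite a0 b0 raddf0 row_mx0.
  have BA : col_mx e v *m A = 1 *: col_mx e v.
    by rewrite mul_col_mx eA vA -elam !scale1r.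
  move=> /(_ (char_poly_dvd_eigenspace Bfree BA)).
  by rewrite -elam minxx sqrtr1 leNgt s1.
have -> : root (char_poly (P^T *m P)) 1.
  by rewrite -eigenvalue_root_char; apply/eigenvalueP; exists e.
have -> : root (char_poly (P^T *m P)) lam.
  by rewrite -eigenvalue_root_char; apply/eigenvalueP; exists v.
move=> /(_ isT) H.
have lam1 : lam < 1.
  rewrite ltNge; apply/negP => lam1; move: H.
  by rewrite min_l // sqrtr1 leNgt s1.
move: H; rewrite min_r ?(ltW lam1) // => H.
by rewrite -[leLHS](sqr_sqrtr lam0) lerXn2r ?nnegrE ?sqrtr_ge0 ?singular_value_ge0.
Qed.

(** The bound passes from [P^T] to [P] without comparing the spectra of [P P^T] and [P^T P]:
    [b = |u P|^2 = <u, u P P^T>], so Cauchy-Schwarz gives [b^2 <= |u|^2 sigma_2^2 b], and [b]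
    cancels. *)
Lemma inner_mulmx_le (R : realType) n (P : 'M[R]_n) (u : 'rV[R]_n) :
  doubly_stochastic P -> singular_value P 2 < 1 -> inner u (const_mx 1) = 0 ->
  inner (u *m P) (u *m P) <= singular_value P 2 ^+ 2 * inner u u.
Proof.
move=> Pds s1 ue; have uPe : inner (u *m P) (const_mx 1) = 0.
  rewrite inner_mulmx.
  by rewrite (const_mx_doubly_stochastic _ (trmx_doubly_stochastic Pds)).
have := inner_mulmx_trmx_le Pds s1 uPe; set s := singular_value _ _.
have := cauchy_schwarz u (u *m P *m P^T).
rewrite -{1}inner_mulmx; set b := inner (u *m P) (u *m P) => H1 H2.
have b0 : 0 <= b by exact: inner_ge0.
have a0 := inner_ge0 u.
have [->|bN] := eqVneq b 0; first by rewrite mulr_ge0 ?sqr_ge0.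
have bp : 0 < b by rewrite lt_neqAle eq_sym bN.
rewrite -(ler_pM2r bp) -expr2; apply: le_trans H1 _.
by rewrite mulrC [leRHS]mulrAC ler_wpM2r.
Qed.

(** * Norm equivalence and dual bounds *)

Section Norm.
Variables (R : realType) (d : nat) (N : 'rV[R]_d -> R).
Hypothesis N_norm : is_norm N.

Lemma norm0E : N 0 = 0.
Proof. by rewrite -(scale0r 0) norm_homogeneous // normr0 mul0r. Qed.

Lemma normNE u : N (- u) = N u.
Proof. by rewrite -scaleN1r norm_homogeneous // normrN1 mul1r. Qed.

Lemma norm_subC u v : N (u - v) = N (v - u).
Proof. by rewrite -normNE opprB. Qed.

Lemma norm_nonneg u : 0 <= N u.
Proof.
have := norm_triangle N_norm u (- u).
by rewrite subrr norm0E normNE -mulr2n pmulrn_lge0.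
Qed.

Lemma norm_pos u : u != 0 -> 0 < N u.
Proof.
move=> u0; rewrite lt_neqAle norm_nonneg andbT eq_sym.
by apply: contraNneq u0 => /(norm_definite N_norm) ->.
Qed.

Lemma norm_sub_triangle w u v : N (u - v) <= N (u - w) + N (w - v).
Proof.
by rewrite -(subrKA w) addrC (le_trans (norm_triangle N_norm _ _)) // addrC.
Qed.

Lemma norm_sum (I : Type) (r : seq I) (F : I -> 'rV[R]_d) :
  N (\sum_(i <- r) F i) <= \sum_(i <- r) N (F i).
Proof.
elim: r => [|i r IH]; first by rewrite !big_nil norm0E.
by rewrite !big_cons (le_trans (norm_triangle N_norm _ _)) // lerD2l.
Qed.

Lemma coord_le_mx_norm (u : 'rV[R]_d) k : `|u 0 k| <= `|u|.
Proof.
rewrite [leRHS]/Num.norm /= mx_normrE.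
exact: (le_bigmax _ (fun ij : 'I_1 * 'I_d => `|u ij.1 ij.2|) (0, k)).
Qed.

Lemma norm_le_mx_norm : exists2 C, 0 <= C & forall u, N u <= C * `|u|.
Proof.
exists (\sum_(k < d) N 'e_k); first by apply: sumr_ge0 => k _; exact: norm_nonneg.
move=> u; rewrite [u in N u]row_sum_delta (le_trans (norm_sum _ _)) // mulr_suml.
apply: ler_sum => k _; rewrite norm_homogeneous // mulrC ler_wpM2l ?norm_nonneg //.
exact: coord_le_mx_norm.
Qed.

(** By the reverse triangle inequality [N] is Lipschitz for the sup norm. *)
Lemma continuous_norm : continuous N.
Proof.
have [C C0 NC] := norm_le_mx_norm.
move=> x; apply/(@cvgrPdist_le _ _ _ (nbhs x)) => e e0.
have C1 : 0 < C + 1 by lra.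
near=> y.
have : `|x - y| <= e / (C + 1).
  near: y; apply: (@cvgr_dist_le _ _ _ (nbhs x) _ id x) => //.
  by rewrite divr_gt0.
rewrite ler_pdivlMr // => xy.
have B1 := NC (x - y); have B2 := normr_ge0 (x - y).
have T1 := norm_sub_triangle y x 0; have T2 := norm_sub_triangle x y 0.
rewrite !subr0 (norm_subC y x) in T1 T2.
by rewrite ler_norml; apply/andP; split; nra.
Unshelve. all: by end_near. Qed.

(** The constant is the minimum of [N] on the compact unit sphere of the sup norm. If 0 is the only
    vector that sphere is empty, and any constant serves. *)
Lemma mx_norm_le_norm : exists2 c, 0 < c & forall u, c * `|u| <= N u.
Proof.
have [[w w0]|allz] := pselect (exists w : 'rV[R]_d, w != 0); last first.
  exists 1 => // u; have [->|u0] := eqVneq u 0; first by rewrite normr0 mulr0 norm0E.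
  by case: allz; exists u.
pose K := [set u : 'rV[R]_d | `|u| = 1].
have normalize (u : 'rV[R]_d) : u != 0 -> K (`|u|^-1 *: u).
  by move=> u0; rewrite /K /= normrZ normfV normr_id mulVf // normr_eq0.
have cK : compact K.
  apply: bounded_closed_compact.
    exists 1; split; first exact: real1.
    by move=> M M1 u /= ->; rewrite ltW.
  have -> : K = (fun u : 'rV[R]_d => `|u|) @^-1` [set 1] by [].
  apply: closed_comp; last exact: closed_eq.
  by move=> u _; exact: norm_continuous.
have K0 : K !=set0 by exists (`|w|^-1 *: w); exact: normalize.
have [|v /set_mem v1 vmin] := @EVT_min_rV R d N K K0 cK.
  by apply: continuous_subspaceT; exact: continuous_norm.
exists (N v).
  apply: norm_pos; apply/eqP => v0; move: v1; rewrite /K /= v0 normr0.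
  by move/eqP; rewrite eq_sym oner_eq0.
move=> u; have [->|u0] := eqVneq u 0; first by rewrite normr0 mulr0 norm0E.
have := vmin _ (mem_set (normalize _ u0)).
rewrite norm_homogeneous // normfV normr_id mulrC ler_pdivlMr ?normr_gt0 //.
Qed.

(** A bound on the dual norm stated without a supremum, so that it can be added and weakened with no
    boundedness side condition. *)
Definition dual_le v C := forall u, inner v u <= C * N u.

Lemma dual_le_exists v : exists2 C, 0 <= C & dual_le v C.
Proof.
have [c c0 cN] := mx_norm_le_norm.
exists (\sum_(k < d) `|v 0 k| / c).
  by apply: sumr_ge0 => k _; rewrite divr_ge0 // ltW.
move=> u; rewrite mulr_suml; apply: ler_sum => k _.
rewrite -mulrA (le_trans (ler_norm _)) // normrM ler_wpM2l //.
rewrite ler_pdivlMl // (le_trans _ (cN u)) // ler_wpM2l ?(ltW c0) //.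
exact: coord_le_mx_norm.
Qed.

(** A supremum dominates its set only if the set is bounded above; equivalence of norms, through
    [dual_le_exists], provides this. *)
Lemma dual_norm_le v C : dual_norm N v <= C -> dual_le v C.
Proof.
move=> vC u; have [->|u0] := eqVneq u 0; first by rewrite innerC inner0l norm0E mulr0.
have Nu := norm_pos u0; rewrite -ler_pdivrMr //; apply: le_trans vC.
have [M _ vM] := dual_le_exists v.
apply: ub_le_sup.
  by exists M => _ [w /= w1 <-]; rewrite (le_trans (vM w)) // w1 mulr1.
exists ((N u)^-1 *: u) => /=; last by rewrite innerZr mulrC.
by rewrite norm_homogeneous // normfV ger0_norm ?mulVf ?gt_eqF ?norm_nonneg.
Qed.

Lemma dual_leN v C : dual_le v C -> dual_le (- v) C.
Proof. by move=> vC u; rewrite innerNl -innerNr (le_trans (vC _)) // normNE. Qed.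

Lemma dual_le_weaken v C D : C <= D -> dual_le v C -> dual_le v D.
Proof. by move=> CD vC u; rewrite (le_trans (vC u)) // ler_wpM2r // norm_nonneg. Qed.

Lemma dual_le_normr v C u : dual_le v C -> `|inner v u| <= C * N u.
Proof.
move=> vC; rewrite ler_norml vC andbT lerNl -innerNl.
exact: (dual_leN vC).
Qed.

End Norm.

(** * The proximal projection *)

Section Prox.
Variables (R : realType) (d : nat) (N : 'rV[R]_d -> R) (X : set 'rV[R]_d).
Variable psi : 'rV[R]_d -> R.
Hypotheses (N_norm : is_norm N) (X_convex : convex_set X).
Hypothesis psi_prox : proximal_function N X psi.

Lemma convex_set_comb (t : R) x y : 0 <= t -> t <= 1 -> X x -> X y ->
  X ((1 - t) *: x + t *: y).
Proof.
move=> t0 t1 Xx Xy; have := X_convex (Itv01 t0 t1) (mem_set Xy) (mem_set Xx).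
by rewrite inE addrC.
Qed.

(** Strong convexity is used from the intermediate point [m] towards [x] and towards [y]; with
    weights [1 - t] and [t] the gradient terms cancel. *)
Lemma prox_comb (t : R) x y : 0 <= t -> t <= 1 -> X x -> X y ->
  psi ((1 - t) *: x + t *: y) + t * (1 - t) / 2 * N (y - x) ^+ 2 <=
  (1 - t) * psi x + t * psi y.
Proof.
move=> t0 t1 Xx Xy; set m := _ *: x + _.
have Xm : X m by exact: convex_set_comb.
have Hx := prox_strongly_convex psi_prox Xm Xx.
have Hy := prox_strongly_convex psi_prox Xm Xy.
have ex : x - m = - t *: (y - x).
  by apply/rowP => k; rewrite /m !mxE; ring.
have ey : y - m = (1 - t) *: (y - x).
  by apply/rowP => k; rewrite /m !mxE; ring.
rewrite !(norm_subC N_norm m) in Hx Hy.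
rewrite ex ey !innerZr !norm_homogeneous // normrN !ger0_norm ?subr_ge0 // in Hx Hy.
move: (inner _ _) (psi m) (psi x) (psi y) (N (y - x)) Hx Hy => g pm px py q Hx Hy.
have t1' : 0 <= 1 - t by rewrite subr_ge0.
have Hx' := ler_wpM2l t1' Hx; have Hy' := ler_wpM2l t0 Hy.
apply: le_trans (lerD Hx' Hy'); rewrite le_eqVlt; apply/orP; left; apply/eqP; by field.
Qed.

(** The objective inherits strong convexity with modulus [1 / a]. Comparing the minimizer with the
    point at parameter [t] on the segment to [y] gives [(1 - t) q <= hy - hx], and [t] tends to
    0. *)
Lemma projection_growth z a x y : 0 < a -> projection X psi z a x -> X y ->
  inner z x + a^-1 * psi x + (2 * a)^-1 * N (y - x) ^+ 2 <=
  inner z y + a^-1 * psi y.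
Proof.
move=> a0 [Xx xmin] Xy.
set hx := inner z x + _; set hy := inner z y + _; set q := _ * _ ^+ 2.
have q0 : 0 <= q by rewrite mulr_ge0 ?sqr_ge0 // invr_ge0 mulr_ge0 // ltW.
have hxy : hx <= hy by exact: xmin.
have slope t : 0 < t -> t <= 1 -> (1 - t) * q <= hy - hx.
  move=> t0 t1; have := xmin _ (convex_set_comb (ltW t0) t1 Xx Xy).
  have ai : 0 <= a^-1 by rewrite invr_ge0 ltW.
  have := ler_wpM2l ai (prox_comb (ltW t0) t1 Xx Xy).
  rewrite -/hx innerDr !innerZr; move: (psi _) => pm H1 H2.
  rewrite -(ler_pM2l t0) /q invfM; move: H1 H2; rewrite /hx /hy.
  move: (N _ ^+ 2) (psi x) (psi y) (inner z x) (inner z y) a^-1.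
  move=> n2 px py zx zy b H1 H2; lra.
rewrite leNgt; apply/negP => lt.
have q1 : 0 < q by lra.
have q2 : 0 < 2 * q by rewrite mulr_gt0.
have num0 : 0 < q - (hy - hx) by lra.
(* A single [t] replaces the limit: here [(1 - t) q] is the midpoint of [q] and [hy - hx], which
   exceeds [hy - hx]. *)
have := slope _ (divr_gt0 num0 q2).
rewrite ler_pdivrMr // mulrBl.
have -> : (q - (hy - hx)) / (2 * q) * q = (q - (hy - hx)) / 2.
  by field; rewrite gt_eqF.
by move=> H; have := H ltac:(lra); lra.
Qed.

(** Adding the growth inequalities at the two minimizers cancels [psi] and leaves
    [N (x - x')^2 / a <= <z - z', x' - x>]. *)
Lemma projection_contraction z z' a x x' C : 0 < a -> 0 <= C ->
  projection X psi z a x -> projection X psi z' a x' ->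
  dual_le N (z - z') C -> N (x - x') <= a * C.
Proof.
move=> a0 C0 px px' zC.
have H1 := projection_growth a0 px (proj1 px').
have H2 := projection_growth a0 px' (proj1 px).
rewrite (norm_subC N_norm x' x) in H1.
have := zC (x' - x); rewrite innerBl !innerBr (norm_subC N_norm x' x) => H3.
have N0 := norm_nonneg N_norm (x - x').
have [N1|N1] := ltrP 0 (N (x - x')); last first.
  by rewrite (le_trans N1) // mulr_ge0 // ltW.
have : a^-1 * N (x - x') ^+ 2 <= C * N (x - x').
  rewrite invfM in H1 H2.
  by move: (inner z x) (inner z x') (inner z' x) (inner z' x')
    (psi x) (psi x') H1 H2 H3 => *; lra.
by rewrite expr2 mulrA ler_pM2r // ler_pdivrMl.
Qed.

(** Provides the centralized sequence. Strong convexity at 0 makes [h] grow quadratically, so the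
    part of [X] where [h <= 0] is compact; it contains 0, and a minimizer there is global. *)
Lemma projection_exists z a : closed X -> X 0 -> 0 < a ->
  exists y, projection X psi z a y.
Proof.
move=> X_closed X0 a0; pose h x := inner z x + a^-1 * psi x.
have ch : continuous h.
  move=> x; apply: cvgD; first exact: (nbhs_filter x).
    apply: (@continuous_inner _ _ _ (fun _ => z) (fun x => x)).
      exact: cst_continuous.
    by move=> y; exact: cvg_id.
  apply: cvgM; first exact: (nbhs_filter x).
    exact: (@cst_continuous _ _ (a^-1) x).
  exact: (differentiable_continuous (prox_differentiable psi_prox x)).
pose K := X `&` [set x | h x <= 0].
have h0 : h 0 = 0 by rewrite /h innerC inner0l (prox_at0 psi_prox) mulr0 addr0.
have [c c0 cN] := mx_norm_le_norm N_norm.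
have [C C0 gC] := dual_le_exists N_norm (- (z + a^-1 *: gradient psi 0)).
have cK : compact K.
  apply: bounded_closed_compact.
    (* On the sublevel set [N x ^+ 2 / (2 a) <= C * N x], hence [N x <= 2 a C]; dividing by [c]
       passes to the sup norm. *)
    exists (2 * a * C / c); split; first exact: num_real.
    move=> M MC x [Xx /= hx]; rewrite (le_trans _ (ltW MC)) //.
    rewrite ler_pdivlMr // mulrC (le_trans (cN x)) //.
    have := prox_strongly_convex psi_prox X0 Xx.
    rewrite (prox_at0 psi_prox) add0r subr0 sub0r normNE // => Hg.
    have := gC x; rewrite innerNl innerDl innerZl => Hd.
    have ai : 0 < a^-1 by rewrite invr_gt0.
    have {}Hg := ler_wpM2l (ltW ai) Hg.
    have N0 := norm_nonneg N_norm x.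
    have [N1|N1] := ltrP 0 (N x); last by rewrite (le_trans N1) // !mulr_ge0 // ltW.
    have : a^-1 / 2 * N x * N x <= C * N x by rewrite /h in hx; lra.
    rewrite ler_pM2r // => H.
    have -> : N x = 2 * a * (a^-1 / 2 * N x) by field; rewrite gt_eqF.
    by rewrite ler_wpM2l // mulr_ge0 // ltW.
  apply: closedI => //; apply: (@closed_comp _ _ h [set t | t <= 0]).
    by move=> x _; exact: ch.
  exact: closed_le.
have K0 : K !=set0 by exists 0; split; rewrite //= h0.
have [|y /set_mem[Xy hy] ymin] := @EVT_min_rV R d h K K0 cK.
  exact: continuous_subspaceT.
exists y; split => // x Xx; have [hx|hx] := leP (h x) 0.
  by apply: ymin; apply/mem_set; split.
by rewrite (le_trans hy) // ltW.
Qed.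

Lemma projection0 a : X 0 -> 0 < a -> projection X psi 0 a 0.
Proof.
move=> X0 a0; split => // y Xy.
rewrite !inner0l !add0r (prox_at0 psi_prox) mulr0 mulr_ge0 ?(prox_ge0 psi_prox) //.
by rewrite invr_ge0 ltW.
Qed.

Lemma norm_le_prox x : X 0 -> X x -> N x ^+ 2 <= 2 * psi x.
Proof.
move=> X0 Xx; have := projection_growth ltr01 (projection0 X0 ltr01) Xx.
rewrite !inner0l (prox_at0 psi_prox) subr0 invr1; lra.
Qed.

End Prox.

(** * Mixing of the communication matrix *)

Section Mixing.
Variables (R : realType) (n : nat) (P : 'M[R]_n).
Hypothesis P_ds : doubly_stochastic P.

Definition l1_norm (w : 'rV[R]_n) := \sum_i `|w 0 i|.

(** The row vector [w P^k], written as an iteration so that a factor [P] can be split off at either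
    end. *)
Definition propagate k (w : 'rV[R]_n) := iter k (mulmxr P) w.

Lemma l1_norm_mulmx w : l1_norm (w *m P) <= l1_norm w.
Proof.
rewrite /l1_norm.
apply: le_trans (_ : \sum_j \sum_i `|w 0 i| * P i j <= _).
  apply: ler_sum => j _; rewrite mxE (le_trans (ler_norm_sum _ _ _)) //.
  by apply: ler_sum => i _; rewrite normrM (ger0_norm (ds_ge0 P_ds i j)).
rewrite exchange_big /=; apply: ler_sum => i _.
by rewrite -mulr_sumr (ds_row P_ds) mulr1.
Qed.

Lemma l1_norm_propagate k w : l1_norm (propagate k w) <= l1_norm w.
Proof. by elim: k => //= k IH; rewrite (le_trans (l1_norm_mulmx _)). Qed.

Lemma l1_norm_le_l2 w : l1_norm w <= Num.sqrt n%:R * Num.sqrt (inner w w).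
Proof.
pose v : 'rV[R]_n := \row_i `|w 0 i|.
have -> : l1_norm w = inner (const_mx 1) v.
  by apply: eq_bigr => i _; rewrite !mxE mul1r.
have -> : inner w w = inner v v.
  by apply: eq_bigr => i _; rewrite !mxE -normrM ger0_norm // -expr2 sqr_ge0.
have -> : n%:R = inner (const_mx 1) (const_mx 1 : 'rV[R]_n).
  rewrite /inner (eq_bigr (fun _ => 1)) ?sumr_const ?card_ord //.
  by move=> i _; rewrite !mxE mul1r.
rewrite -sqrtrM ?inner_ge0 //; apply: le_trans (ler_norm _) _.
by rewrite -sqrtr_sqr ler_wsqrtr // cauchy_schwarz.
Qed.

(** Row sums equal to 1 keep the complement of the constants invariant, so the contraction by
    [sigma_2] applies at every step; passing from l2 to l1 costs [sqrt n]. *)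
Lemma l1_norm_propagate_mix k w :
  singular_value P 2 < 1 -> inner w (const_mx 1) = 0 ->
  l1_norm (propagate k w) <=
  Num.sqrt n%:R * (singular_value P 2 ^+ k * Num.sqrt (inner w w)).
Proof.
move=> s1 we; apply: le_trans (l1_norm_le_l2 _) _.
rewrite ler_wpM2l ?sqrtr_ge0 //.
have s0 := singular_value_ge0 P 2.
have [_ H] : inner (propagate k w) (const_mx 1) = 0 /\
    inner (propagate k w) (propagate k w) <=
    (singular_value P 2 ^+ k) ^+ 2 * inner w w.
  elim: k => [|k [IH1 IH2]]; first by rewrite expr1n mul1r.
  split=> /=.
    rewrite inner_mulmx.
    by rewrite (const_mx_doubly_stochastic _ (trmx_doubly_stochastic P_ds)).
  apply: le_trans (inner_mulmx_le P_ds s1 IH1) _.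
  by rewrite [_ ^+ k.+1]exprS exprMn -[leRHS]mulrA ler_wpM2l ?sqr_ge0.
rewrite -[X in X * _](@ger0_norm R) ?exprn_ge0 // -sqrtr_sqr -sqrtrM ?sqr_ge0 //.
by rewrite ler_wsqrtr.
Qed.

(** The weights that produce [z i - zbar] from the family [z]. *)
Definition deviation (i : 'I_n) : 'rV[R]_n := delta_mx 0 i - const_mx n%:R^-1.

Lemma inner_delta (i : 'I_n) (v : 'rV[R]_n) : inner (delta_mx 0 i) v = v 0 i.
Proof.
rewrite /inner (bigD1 i) //= big1 ?addr0 ?mxE ?eqxx ?mul1r // => j ji.
by rewrite mxE (negPf ji) andbF mul0r.
Qed.

Lemma inner_const (a : R) (v : 'rV[R]_n) :
  inner (const_mx a) v = a * \sum_i v 0 i.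
Proof. by rewrite mulr_sumr; apply: eq_bigr => i _; rewrite mxE. Qed.

Lemma deviation_orth i : inner (deviation i) (const_mx 1) = 0.
Proof.
rewrite innerBl inner_delta inner_const mxE (eq_bigr (fun _ => 1)); last first.
  by move=> j _; rewrite mxE.
rewrite sumr_const card_ord mulVf ?subrr // pnatr_eq0.
by case: (n) i => // -[].
Qed.

Lemma deviation_l2 i : inner (deviation i) (deviation i) <= 1.
Proof.
rewrite {2}/deviation innerBr.
have -> : const_mx n%:R^-1 = n%:R^-1 *: const_mx 1 :> 'rV[R]_n.
  by apply/rowP => j; rewrite !mxE mulr1.
rewrite innerZr deviation_orth mulr0 subr0 innerC inner_delta !mxE !eqxx /=.
by rewrite gerBl invr_ge0.
Qed.

Lemma deviation_l1 i : l1_norm (deviation i) <= 2.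
Proof.
have n0 : n%:R != 0 :> R by rewrite pnatr_eq0; case: (n) i => // -[].
apply: le_trans (_ : \sum_j (((j == i)%:R : R) + n%:R^-1) <= _).
  apply: ler_sum => j _; rewrite !mxE eqxx /= (le_trans (ler_normB _ _)) //.
  by rewrite !ger0_norm ?invr_ge0.
rewrite big_split /= sumr_const card_ord -[_ *+ n]mulr_natl mulfV //.
rewrite (bigD1 i) //= eqxx big1 ?addr0 // => j ji; by rewrite (negPf ji).
Qed.

End Mixing.

Lemma sum_lt_le (R : realType) (B : R) m :
  0 <= B -> \sum_(k < m) ((k%:R < B)%R : nat)%:R <= B + 1.
Proof.
(* The trivial bound by [m] joins the induction: as long as [m < B] it keeps the count below [B]. *)
move=> B0; suff [] : \sum_(k < m) ((k%:R < B)%R : nat)%:R <= B + 1 /\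
   \sum_(k < m) ((k%:R < B)%R : nat)%:R <= m%:R :> R by [].
elim: m => [|m [IH1 IH2]]; first by rewrite big_ord0 addr_ge0.
rewrite big_ord_recr /=; have [mB|Bm] := ltP m%:R B.
  rewrite -[m.+1%:R]natr1 !lerD2r; split=> //.
  by rewrite (le_trans IH2) ?(ltW mB).
by split; rewrite addr0 // (le_trans IH2) // ler_nat.
Qed.

(* Once [k (1 - s) >= ln (T c)], the geometric bound [c s^k] is below [1/T]. *)
Lemma sum_min_geometric_le (R : realType) (T m : nat) (c s : R) (a : nat -> R) :
  (m <= T)%N -> (0 < T)%N -> 1 <= c -> 0 <= s -> s < 1 ->
  (forall k, a k <= 2) -> (forall k, a k <= c * s ^+ k) ->
  \sum_(k < m) a k <= 2 * (ln (T%:R * c) / (1 - s)) + 3.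
Proof.
move=> mT T0 c1 s0 s1 a2 as_.
have T1 : 1 <= T%:R :> R by rewrite ler1n.
have c0 : 0 < c by rewrite (lt_le_trans ltr01).
have Tc0 : 0 < T%:R * c by rewrite mulr_gt0 // ltr0n.
have Tc : 1 <= T%:R * c by rewrite (le_trans T1) // ler_peMr // (le_trans ler01).
have s1' : 0 < 1 - s by rewrite subr_gt0.
set B := _ / (1 - s); have B0 : 0 <= B by rewrite divr_ge0 ?ln_ge0 // ltW.
(* Terms with [k < B] are bounded by 2 and number at most [B + 1]; each other term is at most
   [1 / T], in total at most 1 since [m <= T]. This gives [2 B + 3]. *)
apply: le_trans (_ : \sum_(k < m) (2 * ((k%:R < B)%R : nat)%:R + T%:R^-1) <= _).
  apply: ler_sum => k _; have [kB|Bk] := ltP k%:R B.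
    by rewrite mulr1 (le_trans (a2 k)) // lerDl invr_ge0.
  rewrite mulr0 add0r (le_trans (as_ k)) // -[leRHS]mulr1 ler_pdivlMl ?ltr0n // mulrA.
  rewrite -[leRHS](@mulfV _ (T%:R * c)) ?gt_eqF // ler_wpM2l ?(ltW Tc0) //.
  (* [s = 1 - (1 - s) <= exp (- (1 - s))]. *)
  apply: le_trans (_ : expR (- (1 - s)) ^+ k <= _).
    by rewrite lerXn2r ?nnegrE ?expR_ge0 // (le_trans _ (expR_ge1Dx _)) //; lra.
  rewrite -expRM_natl mulrN expRN lef_pV2 ?posrE ?expR_gt0 //.
  by rewrite -[leLHS]lnK ?posrE // ler_expR -ler_pdivrMr.
rewrite big_split /= -mulr_sumr sumr_const card_ord -mulr_natl.
have := sum_lt_le m B0.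
have : m%:R * T%:R^-1 <= 1 :> R by rewrite ler_pdivrMr ?ltr0n // mul1r ler_nat.
lra.
Qed.

(** * Regret of the network *)

(** Induction on the regularized objective: quadratic growth at its minimizer [y T] absorbs the move
    from [y T] to [u] in the new linear term, up to [beta T * L ^+ 2 / 2]. *)
Lemma dual_averaging_regret (R : realType) (d : nat) (N : 'rV[R]_d -> R)
    (X : set 'rV[R]_d) (psi : 'rV[R]_d -> R) (v y Z : nat -> 'rV[R]_d)
    (beta : nat -> R) (L : R) :
  is_norm N -> convex_set X -> proximal_function N X psi ->
  Z 0%N = 0 -> (forall t, Z t.+1 = Z t + v t) ->
  (forall t, projection X psi (Z t) (beta t) (y t)) ->
  (forall t, dual_le N (v t) L) -> (forall t, 0 < beta t) ->
  (forall t, beta t.+1 <= beta t) ->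
  forall T u, X u ->
    \sum_(t < T) inner (v t) (y t - u) <=
    (beta T)^-1 * psi u + L ^+ 2 / 2 * \sum_(t < T) beta t.
Proof.
move=> N_norm X_convex psi_prox Z0 ZS yP vL beta0 betaS T u Xu.
(* The claim is made for every [u] because the induction step applies it at [y T]. *)
suff H : forall u, X u ->
    \sum_(t < T) (inner (v t) (y t) - beta t / 2 * L ^+ 2) <=
    inner (Z T) u + (beta T)^-1 * psi u.
  have ZT : inner (Z T) u = \sum_(t < T) inner (v t) u.
    elim: T {H} => [|T IH]; first by rewrite Z0 inner0l big_ord0.
    by rewrite ZS innerDl IH big_ord_recr.
  have E1 : \sum_(t < T) inner (v t) (y t - u) =
      \sum_(t < T) inner (v t) (y t) - \sum_(t < T) inner (v t) u.
    by rewrite -sumrB; apply: eq_bigr => t _; rewrite innerBr.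
  have E2 : \sum_(t < T) beta t / 2 * L ^+ 2 = L ^+ 2 / 2 * \sum_(t < T) beta t.
    by rewrite mulr_sumr; apply: eq_bigr => t _; field.
  have := H _ Xu; rewrite ZT sumrB E1 E2; lra.
elim: T => [|T IH] {Xu}u Xu.
  rewrite big_ord0 Z0 inner0l add0r mulr_ge0 ?(prox_ge0 psi_prox) //.
  by rewrite invr_ge0 ltW.
rewrite big_ord_recr /=.
have G := projection_growth N_norm X_convex psi_prox (beta0 T) (yP T) Xu.
have I := IH _ (proj1 (yP T)).
have V := dual_leN N_norm (vL T) (u - y T).
rewrite innerNl innerBr in V.
have psi0 := prox_ge0 psi_prox Xu.
have B : (beta T)^-1 * psi u <= (beta T.+1)^-1 * psi u.
  by rewrite ler_wpM2r // lef_pV2 ?posrE.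
(* Fenchel-Young: [L q <= q^2 / (2 b) + b L^2 / 2] *)
have Y : L * N (u - y T) <= (2 * beta T)^-1 * N (u - y T) ^+ 2 + beta T / 2 * L ^+ 2.
  have b0 := beta0 T; move: (N _) => q; rewrite -subr_ge0.
  have -> : (2 * beta T)^-1 * q ^+ 2 + beta T / 2 * L ^+ 2 - L * q =
     (2 * beta T)^-1 * (q - beta T * L) ^+ 2 by field; rewrite gt_eqF.
  by rewrite mulr_ge0 ?sqr_ge0 // invr_ge0 mulr_ge0 // ltW.
rewrite ZS innerDl.
move: (\sum_(i < T) _) (inner (Z T) u) (inner (Z T) (y T)) (inner (v T) u)
  (inner (v T) (y T)) (_ * psi u) (_ * psi u) (_ * psi (y T)) (L * _)
  (_ * _ ^+ 2) (_ / 2 * L ^+ 2) G I V B Y => *; lra.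
Qed.

Section Run.
Variables (R : realType) (n d : nat) (N : 'rV[R]_d -> R) (X : set 'rV[R]_d).
Variables (psi : 'rV[R]_d -> R) (f : 'I_n -> 'rV[R]_d -> R) (P : 'M[R]_n).
Variables (L : R) (alpha : nat -> R) (x z g : 'I_n -> nat -> 'rV[R]_d).
Hypotheses (N_norm : is_norm N) (X_convex : convex_set X) (X0 : X 0).
Hypotheses (psi_prox : proximal_function N X psi) (P_ds : doubly_stochastic P).
Hypothesis L_ge0 : 0 <= L.
Hypothesis f_lipschitz : forall i, lipschitz_wrt N X L (f i).
Hypothesis run : dual_averaging P X psi f alpha x z g.
Hypothesis g_le : forall i t, dual_le N (g i t.+1) L.
Hypothesis alpha_gt0 : forall t, (0 < t)%N -> 0 < alpha t.

Definition zbar t := \sum_i n%:R^-1 *: z i t.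
Definition gbar t := \sum_i n%:R^-1 *: g i t.

(* The paper's [alpha (t - 1)] at time [t], with the irrelevant [alpha 0]
   replaced by [alpha 1]. *)
Definition step t := alpha (maxn 1 t).

Lemma step_gt0 t : 0 < step t.
Proof. by apply: alpha_gt0; rewrite leq_max. Qed.

(** At time 1 both [z] and [x] vanish, and 0 is a projection of 0 for every positive step size; this
    makes the choice of [step 0] harmless. *)
Lemma iterate_projection i t : projection X psi (z i t.+1) (step t) (x i t.+1).
Proof.
case: t => [|t]; last by rewrite /step (maxn_idPr _) //; exact: (da_x run).
by rewrite (da_z1 run) (da_x1 run); exact: (projection0 psi_prox X0 (step_gt0 _)).
Qed.

Lemma iterate_in i t : X (x i t.+1).
Proof. by case: (iterate_projection i t). Qed.

(** One update turns the weights [w] into [w P] on the earlier dual variables and adds the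
    subgradients with weights [w], at a cost of [L] times the l1 norm. Arbitrary [w] lets the
    induction continue with [w P]. *)
Lemma weighted_dual_le t (w : 'rV[R]_n) :
  dual_le N (\sum_i w 0 i *: z i t.+1)
    (L * \sum_(k < t) l1_norm (propagate P k w)).
Proof.
elim: t w => [|t IH] w u.
  rewrite big1 => [|i _]; last by rewrite (da_z1 run) scaler0.
  by rewrite inner0l big_ord0 mulr0 mul0r.
have -> : \sum_i w 0 i *: z i t.+2 =
    \sum_j (w *m P) 0 j *: z j t.+1 + \sum_i w 0 i *: g i t.+1.
  under eq_bigr => i _ do rewrite (da_z run) // scalerDr.
  rewrite big_split /=; congr (_ + _).
  under eq_bigr => i _ do rewrite scaler_sumr.
  rewrite exchange_big /=; apply: eq_bigr => j _.
  by rewrite mxE scaler_suml; apply: eq_bigr => i _; rewrite scalerA.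
rewrite innerDl big_ord_recl mulrDr mulrDl addrC lerD //=.
  rewrite inner_suml -mulrA mulrC -mulrA /l1_norm mulr_suml.
  apply: ler_sum => i _; rewrite innerZl (le_trans (ler_norm _)) // normrM.
  by rewrite ler_wpM2l // mulrC (dual_le_normr N_norm).
have -> : \sum_(i < t) l1_norm (propagate P (bump 0 i) w) =
    \sum_(k < t) l1_norm (propagate P k (w *m P)).
  by apply: eq_bigr => i _; rewrite /propagate /bump add1n iterSr.
exact: IH.
Qed.

(** The weights [e_i] have l1 norm 1 and propagation does not increase it. *)
Lemma iterate_dual_le i t : dual_le N (z i t.+1) (L * t%:R).
Proof.
have := weighted_dual_le t (delta_mx 0 i).
rewrite (bigD1 i) //= mxE !eqxx scale1r big1 ?addr0 => [|j ji]; last first.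
  by rewrite mxE (negPf ji) andbF scale0r.
apply: dual_le_weaken => //; rewrite ler_wpM2l //.
apply: le_trans (_ : \sum_(k < t) 1 <= _); last by rewrite sumr_const card_ord.
apply: ler_sum => k _; rewrite (le_trans (l1_norm_propagate P_ds _ _)) //.
rewrite /l1_norm (bigD1 i) //= mxE !eqxx normr1 big1 ?addr0 // => j ji.
by rewrite mxE (negPf ji) andbF normr0.
Qed.

Lemma disagreement_dual_le i t T : (0 < T)%N -> (t <= T)%N ->
  singular_value P 2 < 1 ->
  dual_le N (z i t.+1 - zbar t.+1)
    (L * (2 * (ln (T%:R * Num.sqrt n%:R) / (1 - singular_value P 2)) + 3)).
Proof.
move=> T0 tT s1.
have -> : z i t.+1 - zbar t.+1 = \sum_j deviation R i 0 j *: z j t.+1.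
  under [RHS]eq_bigr => j _ do rewrite !mxE eqxx /= scalerBl.
  rewrite sumrB; congr (_ - _).
  rewrite (bigD1 i) //= eqxx scale1r big1 ?addr0 // => j ji.
  by rewrite (negPf ji) scale0r.
apply: dual_le_weaken (weighted_dual_le _ _) => //; rewrite ler_wpM2l //.
have n1 : (1 <= n)%N by case: (n) i => // -[].
apply: (@sum_min_geometric_le _ T t _ _
  (fun k => l1_norm (propagate P k (deviation R i)))) => //.
- by rewrite -[leLHS]sqrtr1 ler_wsqrtr // ler1n.
- exact: singular_value_ge0.
- move=> k; apply: le_trans (l1_norm_propagate P_ds _ _) (deviation_l1 _ _).
move=> k; apply: le_trans (l1_norm_propagate_mix P_ds _ s1 (deviation_orth _ _)) _.
rewrite ler_wpM2l ?sqrtr_ge0 // ler_piMr ?exprn_ge0 ?singular_value_ge0 //.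
by rewrite -[leRHS]sqrtr1 ler_wsqrtr // deviation_l2.
Qed.

Lemma zbar1 : zbar 1 = 0.
Proof. by rewrite /zbar big1 // => i _; rewrite (da_z1 run) scaler0. Qed.

(** Column sums equal to 1 make [P] disappear from the average. *)
Lemma zbarS t : zbar t.+2 = zbar t.+1 + gbar t.+1.
Proof.
rewrite /zbar; under eq_bigr => i _ do rewrite (da_z run) // scalerDr.
rewrite big_split /=; congr (_ + _).
under eq_bigr => i _ do rewrite scaler_sumr.
rewrite exchange_big /=; apply: eq_bigr => j _.
under eq_bigr => i _ do rewrite scalerA mulrC -scalerA.
by rewrite -scaler_suml (ds_col P_ds) scale1r.
Qed.

Lemma gbar_dual_le t : (0 < n)%N -> dual_le N (gbar t.+1) L.
Proof.
move=> n0 u; rewrite inner_suml.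
apply: le_trans (_ : \sum_(i < n) n%:R^-1 * (L * N u) <= _).
  apply: ler_sum => i _; rewrite innerZl ler_wpM2l ?invr_ge0 //; exact: g_le.
rewrite sumr_const card_ord -mulrnAl -[_ *+ n]mulr_natl mulfV ?mul1r //.
by rewrite pnatr_eq0 -lt0n.
Qed.

(** For each [j], moving from [x i] to [x j] through [y] costs [2 L r] by the Lipschitz property;
    the subgradient inequality at [x j] and the replacement of [x j] by [y] cost another [L r]. *)
Lemma objective_gap_le i t (u y : 'rV[R]_d) r : (0 < n)%N -> X u ->
  (forall j, N (x j t.+1 - y) <= r) ->
  network_objective f (x i t.+1) - network_objective f u <=
  inner (gbar t.+1) (y - u) + 3 * L * r.
Proof.
move=> n0 Xu xy; have nn : n%:R != 0 :> R by rewrite pnatr_eq0 -lt0n.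
rewrite /network_objective -mulrBr -sumrB inner_suml.
have -> : 3 * L * r = \sum_(j < n) n%:R^-1 * (3 * L * r).
  by rewrite sumr_const card_ord -mulrnAl -[_ *+ n]mulr_natl mulfV // mul1r.
rewrite -big_split /= mulr_sumr; apply: ler_sum => j _.
rewrite innerZl -mulrDr ler_wpM2l ?invr_ge0 //.
have H1 := f_lipschitz j (iterate_in i t) (iterate_in j t).
have H2 := norm_sub_triangle N_norm y (x i t.+1) (x j t.+1).
have H3 := xy i; have H4 := xy j; rewrite (norm_subC N_norm y) in H2.
have H5 := da_subgradient run j (isT : (0 < t.+1)%N) u.
have H6 := g_le j t (x j t.+1 - y).
have H7 : L * N (x i t.+1 - x j t.+1) <= L * (r + r).
  by rewrite ler_wpM2l // (le_trans H2) // lerD.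
have H8 : L * N (x j t.+1 - y) <= L * r by rewrite ler_wpM2l.
have H9 := le_trans (ler_norm _) H1.
rewrite !innerBr in H5 H6 *; lra.
Qed.

(** No regret argument enters: 0 is the projection of 0, so contraction bounds the distance of the
    iterate from 0 by [step t] times the bound on its dual variable. *)
Lemma objective_gap_crude i t (u : 'rV[R]_d) : (0 < n)%N -> X u ->
  network_objective f (x i t.+1) - network_objective f u <=
  L * (step t * (L * t%:R) + N u).
Proof.
move=> n0 Xu; have nn : n%:R != 0 :> R by rewrite pnatr_eq0 -lt0n.
have xs : N (x i t.+1) <= step t * (L * t%:R).
  rewrite -[x i t.+1]subr0.
  apply: (projection_contraction N_norm X_convex psi_prox (step_gt0 t) _
    (iterate_projection i t) (projection0 psi_prox X0 (step_gt0 t))).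
    by rewrite mulr_ge0.
  by rewrite subr0; exact: iterate_dual_le.
rewrite /network_objective -mulrBr -sumrB.
have -> : L * (step t * (L * t%:R) + N u) =
    \sum_(j < n) n%:R^-1 * (L * (step t * (L * t%:R) + N u)).
  by rewrite sumr_const card_ord -mulrnAl -[_ *+ n]mulr_natl mulfV // mul1r.
rewrite mulr_sumr; apply: ler_sum => j _.
rewrite ler_wpM2l ?invr_ge0 // (le_trans (ler_norm _)) //.
rewrite (le_trans (f_lipschitz j (iterate_in i t) Xu)) // ler_wpM2l //.
by rewrite (le_trans (norm_triangle N_norm _ _)) // normNE // lerD2r.
Qed.

Lemma objective_regret_le i (u : 'rV[R]_d) T : (0 < n)%N -> (0 < T)%N ->
  closed X -> X u -> singular_value P 2 < 1 ->
  (forall t, step t.+1 <= step t) ->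
  \sum_(t < T) (network_objective f (x i t.+1) - network_objective f u) <=
  (step T)^-1 * psi u + (L ^+ 2 / 2 + 3 * L *
    (L * (2 * (ln (T%:R * Num.sqrt n%:R) / (1 - singular_value P 2)) + 3)))
    * \sum_(t < T) step t.
Proof.
move=> n0 T0 X_closed Xu s1 stepS; set D := L * (2 * _ + 3).
have D0 : 0 <= D.
  rewrite mulr_ge0 // addr_ge0 // mulr_ge0 // divr_ge0 ?subr_ge0 ?(ltW s1) //.
  have sn : 1 <= Num.sqrt n%:R :> R by rewrite -[leLHS]sqrtr1 ler_wsqrtr // ler1n.
  by rewrite ln_ge0 // (le_trans sn) // ler_peMl ?ler1n // (le_trans ler01).
(* The index is shifted: time 0 of the regret bound is time 1 of the run, where [zbar] is 0. *)
have [y yP] := choice (fun t =>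
  projection_exists N_norm psi_prox (zbar t.+1) X_closed X0 (step_gt0 t)).
have := dual_averaging_regret N_norm X_convex psi_prox zbar1 zbarS yP
  (fun t => gbar_dual_le t n0) step_gt0 stepS T Xu.
move=> reg; rewrite mulrDl addrA.
apply: le_trans (lerD reg (lexx _)); rewrite mulr_sumr -big_split /=.
apply: ler_sum => t _.
rewrite -[_ * D * _]mulrA [D * _]mulrC.
apply: objective_gap_le => // j.
apply: (projection_contraction N_norm X_convex psi_prox (step_gt0 t) D0
  (iterate_projection j t) (yP t)).
by apply: disagreement_dual_le => //; exact: ltnW.
Qed.

End Run.

(** * Averaging and numerical estimates *)

(** Jensen's inequality for equal weights: the average of [T + 2] points combines the last one, with
    weight [s = 1 / (T + 2)], and the average of the others. *)
Lemma convex_average (R : realType) (d : nat) (F : 'rV[R]_d -> R)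
    (u : nat -> 'rV[R]_d) T : convex_function [set: 'rV[R]_d] F ->
  F (T.+1%:R^-1 *: \sum_(t < T.+1) u t) <=
  T.+1%:R^-1 * \sum_(t < T.+1) F (u t).
Proof.
move=> F_convex; elim: T => [|T IH].
  by rewrite !big_ord_recl !big_ord0 !addr0 invr1 scale1r mul1r.
have n1 : T.+1%:R != 0 :> R by rewrite pnatr_eq0.
have n2 : T.+1%:R + 1 != 0 :> R by rewrite natr1 pnatr_eq0.
set s : R := T.+2%:R^-1.
have s0 : 0 <= s by rewrite invr_ge0.
have s1 : s <= 1 by rewrite invf_le1 ?ltr0n // ler1n.
have sE : 1 - s = s * T.+1%:R by rewrite /s -natr1; field.
have := F_convex (Itv01 s0 s1) (u T.+1) (T.+1%:R^-1 *: \sum_(t < T.+1) u t).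
move=> /(_ (mem_set I) (mem_set I)); rewrite convRE /=.
have -> : conv (Itv01 s0 s1) (u T.+1 : convex_lmodType _)
    (T.+1%:R^-1 *: \sum_(t < T.+1) u t) = s *: \sum_(t < T.+2) u t.
  have -> : \sum_(t < T.+2) u t = \sum_(t < T.+1) u t + u T.+1.
    exact: big_ord_recr.
  rewrite scalerDr addrC.
  suff -> : s *: \sum_(t < T.+1) u t =
      (1 - s) *: (T.+1%:R^-1 *: \sum_(t < T.+1) u t) by [].
  by rewrite scalerA sE mulfK.
move=> H; apply: le_trans H _.
have -> : \sum_(t < T.+2) F (u t) = \sum_(t < T.+1) F (u t) + F (u T.+1).
  exact: big_ord_recr.
rewrite mulrDr addrC lerD //.
apply: le_trans (_ : (1 - s) * (T.+1%:R^-1 * \sum_(t < T.+1) F (u t)) <= _).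
  by rewrite ler_wpM2l // subr_ge0.
by rewrite sE mulrA mulfK.
Qed.

Lemma network_objective_average (R : realType) (n d : nat)
    (f : 'I_n -> 'rV[R]_d -> R) (u : nat -> 'rV[R]_d) (v : 'rV[R]_d) T :
  (forall i, convex_function [set: 'rV[R]_d] (f i)) -> (0 < T)%N ->
  network_objective f (running_average u T) - network_objective f v <=
  T%:R^-1 * \sum_(t < T) (network_objective f (u t.+1) - network_objective f v).
Proof.
case: T => // T f_convex _; rewrite sumrB sumr_const card_ord mulrBr.
rewrite -[network_objective f v *+ _]mulr_natl mulKf ?pnatr_eq0 // lerD2r.
rewrite /network_objective /running_average big_add1 big_mkord -mulr_sumr.
rewrite mulrCA ler_wpM2l ?invr_ge0 // exchange_big mulr_sumr /=.
apply: ler_sum => i _.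
exact: (convex_average (fun t => u t.+1) T (f_convex i)).
Qed.

Lemma sum_inv_sqrt_le (R : realType) T :
  \sum_(t < T) (Num.sqrt (maxn 1 t)%:R)^-1 <= 2 * Num.sqrt T%:R :> R.
Proof.
case: T => [|[|T]]; first by rewrite big_ord0 sqrtr0 mulr0.
  by rewrite big_ord_recl big_ord0 /= sqrtr1 invr1; lra.
(* The last summand is [1 / sqrt (T + 1)], so the induction needs this sharper radicand: it
   telescopes by [1 / sqrt (k + 1) <= 2 (sqrt (k + 1) - sqrt k)]. *)
apply: le_trans (_ : 2 * Num.sqrt T.+1%:R <= _); last first.
  by rewrite ler_wpM2l // ler_wsqrtr // ler_nat.
elim: T => [|T IH].
  by rewrite !big_ord_recl big_ord0 /= sqrtr1 invr1; lra.
rewrite big_ord_recr /= (maxn_idPr _) //.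
apply: le_trans (lerD IH (lexx _)) _.
have a0 : 0 < Num.sqrt T.+1%:R :> R by rewrite sqrtr_gt0 ltr0n.
have b0 : 0 < Num.sqrt T.+2%:R :> R by rewrite sqrtr_gt0 ltr0n.
have a2 : Num.sqrt T.+1%:R ^+ 2 = T.+1%:R :> R by rewrite sqr_sqrtr ?ler0n.
have b2 : Num.sqrt T.+2%:R ^+ 2 = T.+1%:R + 1 :> R by rewrite sqr_sqrtr ?ler0n ?natr1.
rewrite -(ler_pM2r b0) mulrDl mulVf ?gt_eqF //.
have := sqr_ge0 (Num.sqrt T.+2%:R - Num.sqrt T.+1%:R : R); lra.
Qed.

Lemma ln2_ge_half (R : realType) : 2^-1 <= ln 2 :> R.
Proof.
(* [ln (1 + x) <= x] at [x = - 1/2]. *)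
have := @le_ln1Dx R (- 2^-1); rewrite (_ : 1 + - 2^-1 = 2^-1); last by field.
rewrite lnV ?posrE // lerN2; apply; lra.
Qed.

Lemma ln_ge_quarter (R : realType) k T n : (2 ^ k <= T)%N -> (2 <= n)%N ->
  (2 * k + 1)%:R / 4 <= ln (T%:R * Num.sqrt n%:R) :> R.
Proof.
move=> kT n2; have T0 : (0 < T)%N by rewrite (leq_trans _ kT) // expn_gt0.
have n0 : (0 < n)%N by exact: ltnW.
have sn : 0 < Num.sqrt n%:R :> R by rewrite sqrtr_gt0 ltr0n.
rewrite lnM ?posrE ?ltr0n //.
have H1 : k%:R * ln 2 <= ln T%:R :> R.
  rewrite mulr_natl -lnXn // ler_ln ?posrE ?exprn_gt0 ?ltr0n //.
  by rewrite -natrX ler_nat.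
have H2 : ln 2 <= 2 * ln (Num.sqrt n%:R) :> R.
  rewrite mulr_natl -lnXn // sqr_sqrtr ?ler0n // ler_ln ?posrE ?ltr0n //.
  by rewrite ler_nat.
have H3 := ln2_ge_half R.
have H4 : k%:R * 2^-1 <= k%:R * ln 2 :> R by rewrite ler_wpM2l.
rewrite natrD natrM; lra.
Qed.

Lemma crude_numeric (R : realType) T n : (0 < T)%N -> (T < 16)%N -> (2 <= n)%N ->
  (3 / 2 + Num.sqrt T%:R / 4) * Num.sqrt T%:R <=
  8 * ln (T%:R * Num.sqrt n%:R) :> R.
Proof.
move=> T0 T16 n2.
(* [2 ^ k <= T] bounds the logarithm below and [T <= q ^ 2] bounds the root above. The ranges 1, 2
   to 3 and 4 to 15 use [(k, q)] equal to [(0, 1)], [(1, 2)] and [(2, 4)]; the last is an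
   equality. *)
suff [k [q [kT [Tq qk]]]] : exists k q : nat, (2 ^ k <= T)%N /\ (T <= q ^ 2)%N /\
   (3 / 2 + q%:R / 4) * q%:R <= 2 * (2 * k + 1)%:R :> R.
  have := @ln_ge_quarter R _ _ _ kT n2.
  have r0 : 0 <= Num.sqrt T%:R :> R by exact: sqrtr_ge0.
  have rq : Num.sqrt T%:R <= q%:R :> R.
    rewrite -[leRHS]ger0_norm ?ler0n // -sqrtr_sqr ler_wsqrtr // -natrX.
    by rewrite ler_nat.
  have q0 : 0 <= q%:R :> R by [].
  move: (Num.sqrt T%:R) (ln _) (q%:R) r0 rq q0 qk => r l q' *; nra.
have [T2|T2] := ltnP T 2; first by exists 0%N, 1%N; do 2?split; [| |lra].
have [T4|T4] := ltnP T 4; first by exists 1%N, 2%N; do 2?split; [|exact: ltnW|lra].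
by exists 2%N, 4%N; do 2?split; [|exact: ltnW|lra].
Qed.

Lemma regret_constant_le (R : realType) (rad L r s l : R) :
  0 < rad -> 0 < L -> 0 < r -> 0 < s -> s <= 1 -> 7 / 4 <= l ->
  r / (rad * s / (4 * L)) * rad ^+ 2 +
  (L ^+ 2 / 2 + 3 * L * (L * (2 * (l / s ^+ 2) + 3))) *
    (rad * s / (4 * L) * (2 * r)) <=
  8 * rad * L * r * (l / s).
Proof.
move=> rad0 L0 r0 s0 s1 l1.
(* As [s <= 1], it remains that [4 + 3 l + 19/4 <= 8 l], which is exactly [l >= 7/4]. *)
have -> : r / (rad * s / (4 * L)) * rad ^+ 2 +
    (L ^+ 2 / 2 + 3 * L * (L * (2 * (l / s ^+ 2) + 3))) *
    (rad * s / (4 * L) * (2 * r)) =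
    rad * L * r / s * (4 + 3 * l + 19 / 4 * s ^+ 2).
  by field; rewrite !gt_eqF.
have -> : 8 * rad * L * r * (l / s) = rad * L * r / s * (8 * l) by ring.
rewrite ler_wpM2l //; first by rewrite divr_ge0 ?ltW // !mulr_gt0.
have : s ^+ 2 <= 1 by rewrite expr_le1 // ltW.
lra.
Qed.

Theorem theorem2 (R : realType) (n d : nat) (n_ge2 : (2 <= n)%N)
  (E : rel 'I_n) (E_sym : symmetric E)
  (f : 'I_n -> 'rV[R]_d -> R)
  (f_convex : forall i, convex_function [set: 'rV[R]_d] (f i))
  (X : set 'rV[R]_d) (X_closed : closed X) (X_convex : convex_set X) (X0 : X 0)
  (N : 'rV[R]_d -> R) (N_norm : is_norm N)
  (L : R) (L_gt0 : 0 < L)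
  (f_lipschitz : forall i, lipschitz_wrt N X L (f i))
  (subgradient_bound : forall i x g,
     X x -> subdifferential (f i) x g -> dual_norm N g <= L)
  (psi : 'rV[R]_d -> R) (psi_prox : proximal_function N X psi)
  (P : 'M[R]_n) (P_ds : doubly_stochastic P) (P_graph : respects_graph E P)
  (sigma2_lt1 : singular_value P 2 < 1)
  (rad : R) (rad_gt0 : 0 < rad)
  (xstar : 'rV[R]_d) (xstar_X : X xstar) (xstar_rad : psi xstar <= rad ^+ 2)
  (alpha : nat -> R)
  (alphaE : forall t, (0 < t)%N ->
     alpha t = rad * Num.sqrt (1 - singular_value P 2)
               / (4 * L * Num.sqrt t%:R))
  (x z g : 'I_n -> nat -> 'rV[R]_d)
  (run : dual_averaging P X psi f alpha x z g) :
  forall (i : 'I_n) (T : nat), (1 <= T)%N ->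
    network_objective f (running_average (x i) T) - network_objective f xstar
    <= 8 * (rad * L / Num.sqrt T%:R)
       * (ln (T%:R * Num.sqrt n%:R) / Num.sqrt (1 - singular_value P 2)).
Proof.
have N0 := norm_nonneg N_norm.
set sg := singular_value P 2; set s := Num.sqrt (1 - sg).
have sg1 : 0 < 1 - sg by rewrite subr_gt0.
have s0 : 0 < s by rewrite sqrtr_gt0.
have s1 : s <= 1.
  by rewrite -[leRHS]sqrtr1 ler_wsqrtr // gerBl singular_value_ge0.
have s2 : s ^+ 2 = 1 - sg by rewrite sqr_sqrtr // ltW.
set c := rad * s / (4 * L).
have c0 : 0 < c by rewrite divr_gt0 ?mulr_gt0.
have n0 : (0 < n)%N by exact: ltnW.
have alpha_c t : (0 < t)%N -> alpha t = c / Num.sqrt t%:R.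
  by move=> t0; rewrite alphaE // /c -[RHS]mulrA -invfM.
have alpha_gt0 t : (0 < t)%N -> 0 < alpha t.
  by move=> t0; rewrite alpha_c // divr_gt0 // sqrtr_gt0 ltr0n.
have stepE t : step alpha t = c / Num.sqrt (maxn 1 t)%:R.
  by rewrite /step alpha_c // leq_max.
have stepS t : step alpha t.+1 <= step alpha t.
  rewrite !stepE ler_wpM2l ?(ltW c0) // lef_pV2 ?posrE ?sqrtr_gt0 ?ltr0n ?leq_max //.
  by rewrite ler_wsqrtr // ler_nat geq_max !leq_max leqnn leqnSn !orbT.
have x_in i t : X (x i t.+1).
  exact: (iterate_in X0 psi_prox run alpha_gt0).
have g_le i t : dual_le N (g i t.+1) L.
  apply: (dual_norm_le N_norm); apply: (subgradient_bound i (x i t.+1)) => //.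
  exact: (da_subgradient run).
move=> i T T0; set l := ln _; set r := Num.sqrt T%:R.
have r0 : 0 < r by rewrite sqrtr_gt0 ltr0n.
have r2 : r ^+ 2 = T%:R by rewrite sqr_sqrtr.
apply: le_trans (network_objective_average (x i) xstar f_convex T0) _.
rewrite -r2 ler_pdivrMl ?exprn_gt0 //.
have -> : r ^+ 2 * (8 * (rad * L / r) * (l / s)) = 8 * rad * L * r * (l / s).
  by field; rewrite !gt_eqF.
have [T16|T16] := ltnP T 16.
  have gap t : (t < T)%N ->
      network_objective f (x i t.+1) - network_objective f xstar <=
      rad * L * (3 / 2 + r / 4).
    move=> tT.
    apply: le_trans (objective_gap_crude N_norm X_convex X0 psi_prox P_ds
      (ltW L_gt0) f_lipschitz run g_le alpha_gt0 i t n0 xstar_X) _.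
    (* [N xstar ^+ 2 <= 2 * psi xstar <= 2 * rad ^+ 2], and [3/2] is a rational bound for
       [sqrt 2]. *)
    have xs : N xstar <= 3 / 2 * rad.
      rewrite -(@ler_pXn2r _ 2) ?nnegrE ?mulr_ge0 ?(ltW rad_gt0) //.
      have := norm_le_prox N_norm X_convex psi_prox X0 xstar_X.
      have := sqr_ge0 rad; lra.
    have st : step alpha t * (L * t%:R) <= rad / 4 * r.
      rewrite stepE; case: t tT => [|t] tT.
        by rewrite !mulr0 mulr_ge0 ?divr_ge0 // ltW.
      rewrite (maxn_idPr _) //; set q := Num.sqrt _.
      have q0 : 0 < q by rewrite sqrtr_gt0 ltr0n.
      have -> : t.+1%:R = q ^+ 2 by rewrite sqr_sqrtr.
      have -> : c / q * (L * q ^+ 2) = rad / 4 * (s * q).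
        by rewrite /c; field; rewrite !gt_eqF.
      rewrite ler_wpM2l ?divr_ge0 ?(ltW rad_gt0) //.
      apply: le_trans (_ : q <= _); first by rewrite ler_piMl ?(ltW q0).
      by rewrite ler_wsqrtr // ler_nat ltnW.
    rewrite [rad * L]mulrC -[leRHS]mulrA ler_wpM2l ?(ltW L_gt0) //; lra.
  apply: le_trans (_ : \sum_(t < T) rad * L * (3 / 2 + r / 4) <= _).
    by apply: ler_sum => t _; exact: gap.
  rewrite sumr_const card_ord -[_ *+ T]mulr_natl -r2.
  have rl : (3 / 2 + r / 4) * r <= 8 * l by exact: crude_numeric.
  have l0 : 0 <= l.
    have : 0 <= (3 / 2 + r / 4) * r by rewrite mulr_ge0 ?addr_ge0 ?divr_ge0 ?ltW.
    lra.
  have ls : l <= l / s by rewrite ler_pdivlMr // ler_piMr.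
  have -> : r ^+ 2 * (rad * L * (3 / 2 + r / 4)) =
    rad * L * r * ((3 / 2 + r / 4) * r) by ring.
  have -> : 8 * rad * L * r * (l / s) = rad * L * r * (8 * (l / s)) by ring.
  rewrite ler_wpM2l ?mulr_ge0 ?(ltW rad_gt0) ?(ltW L_gt0) ?(ltW r0) //; lra.
(* Since [2 ^ 4 <= T], the logarithm is even at least [9/4]. *)
have l1 : 7 / 4 <= l.
  have := @ln_ge_quarter R 4 T n T16 n_ge2; rewrite -/l; lra.
apply: le_trans (regret_constant_le rad_gt0 L_gt0 r0 s0 s1 l1).
apply: le_trans (objective_regret_le N_norm X_convex X0 psi_prox P_ds
  (ltW L_gt0) f_lipschitz run g_le alpha_gt0 i n0 T0 X_closed xstar_X
  sigma2_lt1 stepS) _.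
rewrite -/sg -s2 -/l -/c.
apply: lerD.
  rewrite stepE (maxn_idPr _) // invf_div.
  by rewrite ler_wpM2l // divr_ge0 ?ltW.
have D0 : 0 <= L ^+ 2 / 2 + 3 * L * (L * (2 * (l / s ^+ 2) + 3)).
  have l0 : 0 <= l by lra.
  by rewrite addr_ge0 ?mulr_ge0 ?addr_ge0 ?mulr_ge0 ?invr_ge0
    ?exprn_ge0 ?(ltW L_gt0) ?(ltW s0).
rewrite ler_wpM2l //.
rewrite (eq_bigr (fun t : 'I_T => c * (Num.sqrt (maxn 1 t)%:R)^-1)); last first.
  by move=> t _; rewrite stepE.
by rewrite -mulr_sumr ler_wpM2l ?(ltW c0) // sum_inv_sqrt_le.
Qed.
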